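(* Let $n\ge 3$ be an integer distinct from $3$ and $5$. The subgraph induced in $\Lambda(2)$ by the polygons with $n$ or $n+1$ vertices is disconnected.
   Context: A lattice polygon is a $2$-dimensional convex polygon in $\mathbb{R}^2$ whose vertices all belong to $\mathbb{Z}^2$. Let $P\subset\mathbb{R}^2$ be a $2$-dimensional polygon with vertex set $\mathcal{V}$. A point $x\in\mathbb{R}^2\setminus P$ can be inserted in $P$ if the vertex set of the convex hull of $P\cup\{x\}$ is exactly $\mathcal{V}\cup\{x\}$; the insertion move then replaces $P$ by this convex hull. A vertex $v\in\mathcal{V}$ can be deleted from $P$ if the convex hull of $\mathcal{V}\setminus\{v\}$ is still $2$-dimensional; the deletion move then replaces $P$ by this convex hull. $\Lambda(2)$ is the undirected graph whose vertices are all the ($2$-dimensional) lattice polygons in $\mathbb{R}^2$ and whose edges connect two lattice polygons when one is obtained from the other by a single insertion move (equivalently, the other by a single deletion move). *)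

(* Defs.v *)
From HB Require Import structures.
From mathcomp Require Import all_boot all_order all_algebra.
From mathcomp Require Import boolp classical_sets functions cardinality.
From mathcomp Require Import interval_inference reals convex.
From Stdlib Require Import Relation_Operators.

Set Implicit Arguments.
Unset Strict Implicit.
Unset Printing Implicit Defensive.

Import Order.TTheory GRing.Theory Num.Theory.

Local Open Scope classical_set_scope.
Local Open Scope ring_scope.
Local Open Scope convex_scope.
Local Open Scope card_scope.

Record graph (T : Type) := Graph {
  gvert : set T;
  gedge : T -> T -> Prop;
  gedge_vert : forall x y, gedge x y -> gvert x /\ gvert y;
  gedge_sym : forall x y, gedge x y -> gedge y x
}.

Section Subgraph.
Variables (T : Type) (G : graph T) (A : set T).

Definition induced_edge (x y : T) := [/\ A x, A y & gedge G x y].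

Lemma induced_edge_vert x y :
  induced_edge x y -> (gvert G `&` A) x /\ (gvert G `&` A) y.
Proof. by case=> Ax Ay e; have [Gx Gy] := gedge_vert e. Qed.

Lemma induced_edge_sym x y : induced_edge x y -> induced_edge y x.
Proof. by case=> Ax Ay e; split=> //; apply: gedge_sym. Qed.

Definition induced_subgraph : graph T :=
  Graph induced_edge_vert induced_edge_sym.

End Subgraph.

(* In particular a disconnected graph is nonempty. *)
Definition disconnected (T : Type) (G : graph T) :=
  exists x y, [/\ gvert G x, gvert G y & ~ clos_refl_trans T (gedge G) x y].

Section LatticePolygons.
Variable R : realType.

Local Notation point := (convex_lmodType 'rV[R]_2).

Definition conv_hull (A : set point) : set point :=
  smallest (@convex_set R 'rV[R]_2) A.

(* The vertices (0-dimensional faces) of a polygon are its extreme points. *)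
Definition vertices (P : set point) : set point :=
  [set v | P v /\ forall (x y : point) (t : {i01 R}), P x -> P y ->
     0 < t%:num < 1 -> v = x <| t |> y -> x = v /\ y = v].

(* Three affinely independent points of P. *)
Definition two_dimensional (P : set point) :=
  exists a b c : 'rV[R]_2,
    [/\ P a, P b, P c & \rank (col_mx (b - a) (c - a)) = 2%N].

Definition polygon (P : set point) :=
  two_dimensional P /\
  exists2 S : set point, finite_set S & P = conv_hull S.

Definition integer_points : set point :=
  [set v : 'rV[R]_2 | v \is a mxOver Num.int].

Definition lattice_polygon (P : set point) :=
  polygon P /\ vertices P `<=` integer_points.

Definition can_be_inserted (x : point) (P : set point) :=
  ~ P x /\ vertices (conv_hull (P `|` [set x])) = vertices P `|` [set x].

Definition insertion_move (P Q : set point) :=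
  exists2 x, can_be_inserted x P & Q = conv_hull (P `|` [set x]).

Definition Lambda2_edge (P Q : set point) :=
  [/\ lattice_polygon P, lattice_polygon Q &
      insertion_move P Q \/ insertion_move Q P].

Lemma Lambda2_edge_vert P Q :
  Lambda2_edge P Q -> lattice_polygon P /\ lattice_polygon Q.
Proof. by case. Qed.

Lemma Lambda2_edge_sym P Q : Lambda2_edge P Q -> Lambda2_edge Q P.
Proof. by case=> hP hQ [h|h]; split=> //; [right|left]. Qed.

Definition Lambda2 : graph (set point) :=
  @Graph _ lattice_polygon Lambda2_edge Lambda2_edge_vert Lambda2_edge_sym.

Definition has_n_vertices (n : nat) (P : set point) := vertices P #= `I_n.

End LatticePolygons.

(* Main.v *)
Require Import Defs.
From mathcomp Require Import all_boot all_order all_algebra.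
From mathcomp Require Import finmap boolp classical_sets functions cardinality.
From mathcomp Require Import interval_inference reals convex.
From mathcomp Require Import zify ring lra.
From Stdlib Require Import Relation_Operators.

(** The graph is disconnected because it has an isolated vertex, an [n]-gon [P]
    into which no lattice point can be inserted, and at least one other vertex,
    a translate of [P]. Such a [P] has no neighbour with [n.+1] vertices, and its
    neighbours in the whole graph, obtained by deleting a vertex, have only
    [n.-1] of them ([hull_isolated]).

    Inserting a point [x] keeps all the old vertices only when [x] is strictly
    beyond one edge of [P] and strictly on the inner side of the two adjacent
    edges: if [x] is beyond an edge and not strictly inside with respect to an
    adjacent one, their common endpoint lies in the convex hull of [x] and of
    its own two neighbours, hence is not extreme any more ([blocked_vertex]).
    So [P] admits no insertion as soon as, for each edge, the region cut out by
    the lines of the two adjacent edges beyond that edge contains no lattice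
    point. This is [saturated_cycle], and [not_insertable] is the conclusion.

    The polygons are bounded below by the points [(i, f i)] and above by the
    points [(i, g i)], [0 <= i <= m], with [f] strictly convex and [g] strictly
    concave. Beyond the edge between the abscissas [i] and [i + 1], the region
    above lies in the open strip [i < x < i + 1] as soon as the adjacent edges
    are on either side of that strip, so it contains no lattice point whatever
    the values of [f] and [g] ([chord_gap_left], [chord_gap_right]). Only the
    right end and the left end require a choice of [f] and [g].
    - If [n = 2m + 2], take [f i = i (i - m)] and [g i = 1 - f i]; both ends are
      vertical edges of length 1 ([even_cycle]). Here [m] is at least 1.
    - If [n = 2m + 1], the chains share their left endpoint: [f 0 = g 0 = 0],
      [f i = i^2 - m i + 1] and [g i = - (i^2 - (m + 1) i + 1)] for [i > 0]
      ([odd_cycle]). The vertical edge on the right has length [m - 2], which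
      has to be positive; this is where [n = 3] and [n = 5] drop out. *)

Set Implicit Arguments.
Unset Strict Implicit.
Unset Printing Implicit Defensive.

Import Order.TTheory GRing.Theory Num.Theory.

(** * Convex hulls and extreme points *)

Section Hulls.
Local Open Scope classical_set_scope.
Local Open Scope ring_scope.
Local Open Scope convex_scope.
Variable R : realType.
Implicit Types (A C P : set (convex_lmodType 'rV[R]_2)) (p x y : 'rV[R]_2).

Lemma convex_setP C : convex_set C <->
  forall x y (t : R), C x -> C y -> 0 < t -> t < 1 -> C (t *: x + (1 - t) *: y).
Proof.
split=> [cC x y t Cx Cy t0 t1|cC].
  by apply/set_mem; apply: (cC x y (Itv01 (ltW t0) (ltW t1))); apply/mem_set.
apply/convex_setW => x y /set_mem Cx /set_mem Cy k k0 k1; apply/mem_set.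
exact: cC.
Qed.

(** The weights are not normalized because the combinations used below have
    areas of triangles as weights. *)
Lemma convex_weighted2 C x y p (a b : R) : convex_set C -> C x -> C y ->
  0 <= a -> 0 <= b -> 0 < a + b -> (a + b) *: p = a *: x + b *: y -> C p.
Proof.
move=> /convex_setP cC Cx Cy a0 b0 ab0 pE.
have -> : p = (a + b)^-1 *: (a *: x + b *: y).
  by rewrite -pE scalerA mulVf ?scale1r// gt_eqF.
have [a00|an0] := eqVneq a 0.
  have bn0 : b != 0 by move: ab0; rewrite a00 add0r => /gt_eqF ->.
  by rewrite a00 add0r scale0r add0r scalerA mulVf// scale1r.
have [b00|bn0] := eqVneq b 0.
  by rewrite b00 addr0 scale0r addr0 scalerA mulVf// scale1r.
have ap : 0 < a by rewrite lt_neqAle eq_sym an0.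
have bp : 0 < b by rewrite lt_neqAle eq_sym bn0.
have nz : a + b != 0 by rewrite gt_eqF.
have := cC x y (a / (a + b)) Cx Cy.
have -> : 1 - a / (a + b) = b / (a + b) by field.
rewrite scalerDr !scalerA ![(a + b)^-1 * _]mulrC; apply.
  by rewrite divr_gt0.
by rewrite ltr_pdivrMr// mul1r ltrDl.
Qed.

Lemma convex_weighted3 C x y z p (a b c : R) :
  convex_set C -> C x -> C y -> C z ->
  0 <= a -> 0 <= b -> 0 <= c -> 0 < a + b + c ->
  (a + b + c) *: p = a *: x + b *: y + c *: z -> C p.
Proof.
move=> cC Cx Cy Cz a0 b0 c0 s0 pE.
have [ab0|abn0] := eqVneq (a + b) 0.
  have [a00 b00] : a = 0 /\ b = 0 by split; lra.
  apply: (convex_weighted2 (a := 0) (b := c) cC Cx Cz) => //; first by lra.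
  by move: pE; rewrite a00 b00 !add0r !scale0r !add0r.
have abp : 0 < a + b by rewrite lt_neqAle eq_sym abn0 addr_ge0.
pose q := (a + b)^-1 *: (a *: x + b *: y).
have qE : (a + b) *: q = a *: x + b *: y by rewrite scalerA mulfV// scale1r.
have Cq : C q by apply: (convex_weighted2 (a := a) (b := b) cC Cx Cy).
apply: (convex_weighted2 (a := a + b) (b := c) cC Cq Cz) => //.
  exact: ltW.
by rewrite qE.
Qed.

Lemma convex_conv_hull A : convex_set (conv_hull A).
Proof.
apply/convex_setP => x y t hx hy t0 t1 C [cC AC].
by move/convex_setP: (cC); apply=> //; [apply: hx|apply: hy].
Qed.

Lemma sub_conv_hull A : A `<=` conv_hull A.
Proof. exact: sub_gen_smallest. Qed.

Lemma conv_hull_min A C : convex_set C -> A `<=` C -> conv_hull A `<=` C.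
Proof. by move=> cC AC; apply: smallest_sub. Qed.

Lemma vertex_weighted2 P v x y (a b : R) : vertices P v -> P x -> P y ->
  0 < a -> 0 < b -> (a + b) *: v = a *: x + b *: y -> x = v.
Proof.
move=> [_ ext] Px Py a0 b0 vE.
have s0 : 0 < a + b by rewrite addr_gt0.
have nz : a + b != 0 by rewrite gt_eqF.
have t0 : 0 < a / (a + b) by rewrite divr_gt0.
have t1 : a / (a + b) < 1 by rewrite ltr_pdivrMr// mul1r ltrDl.
have [] // := ext x y (Itv01 (ltW t0) (ltW t1)) Px Py.
  by rewrite /= t0 t1.
suff: v = a / (a + b) *: x + (1 - a / (a + b)) *: y by [].
have -> : 1 - a / (a + b) = b / (a + b) by field.
rewrite ![_ / (a + b)]mulrC -!scalerA -scalerDr -vE scalerA.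
by rewrite mulVf// scale1r.
Qed.

(** Removing an extreme point from a convex set leaves a convex set: if the
    point were not in [A], the hull without it would be a smaller convex set
    containing [A]. *)
Lemma vertices_conv_hull_sub A : vertices (conv_hull A) `<=` A.
Proof.
move=> v [hv ext]; apply: contrapT => nAv.
suff : conv_hull A `<=` conv_hull A `\ v by move=> /(_ v hv) [_]; apply.
apply: conv_hull_min; last first.
  move=> a Aa; split; first exact: sub_conv_hull.
  by move=> av; case: nAv; rewrite -av.
apply/convex_setP => x y t [hx xv] [hy yv] t0 t1; split.
  by move/convex_setP: (@convex_conv_hull A); apply.
move=> /= e; case: (xv).
have [] // := ext x y (Itv01 (ltW t0) (ltW t1)) hx hy.
by rewrite /= t0 t1.
Qed.

End Hulls.

(** * Signed areas *)

Section Area.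
Local Open Scope ring_scope.
Variable A : comNzRingType.
Implicit Types p q r s a b c : 'rV[A]_2.

(** Twice the signed area of the triangle [p q r]; it is positive when [r] is on
    the left of the line oriented from [p] to [q]. *)
Definition area p q r : A :=
  (q 0 0 - p 0 0) * (r 0 1 - p 0 1) - (q 0 1 - p 0 1) * (r 0 0 - p 0 0).

Lemma row2P p q : p 0 0 = q 0 0 -> p 0 1 = q 0 1 -> p = q.
Proof.
move=> e0 e1; apply/rowP => -[[|[|//]] k2].
  by rewrite (_ : Ordinal k2 = 0)//; apply: val_inj.
by rewrite (_ : Ordinal k2 = 1)//; apply: val_inj.
Qed.

Lemma area_rot p q r : area p q r = area q r p.
Proof. by rewrite /area; ring. Qed.

Lemma area_swap p q r : area p r q = - area p q r.
Proof. by rewrite /area; ring. Qed.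

Lemma area_split a b c p : area a b c = area b c p + area c a p + area a b p.
Proof. by rewrite /area; ring. Qed.

Lemma barycentric a b c p :
  area a b c *: p = area b c p *: a + area c a p *: b + area a b p *: c.
Proof. by apply: row2P; rewrite !mxE /area; ring. Qed.

Lemma area_conv (t : A) a b p q :
  area a b (t *: p + (1 - t) *: q) = t * area a b p + (1 - t) * area a b q.
Proof. by rewrite /area !mxE; ring. Qed.

Lemma area_translate t a b c : area (a + t) (b + t) (c + t) = area a b c.
Proof. by rewrite /area !mxE; ring. Qed.

Lemma areaqq a b : area a b b = 0.
Proof. by rewrite /area; ring. Qed.

Lemma areapp a b : area a b a = 0.
Proof. by rewrite /area; ring. Qed.

End Area.

(** * Saturated lattice polygons *)

Section Cycles.
Local Open Scope ring_scope.
Variables (N : nat) (v : 'I_N -> 'rV[int]_2).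

Lemma ordS_val (i : 'I_N) :
  ordS i = (if i.+1 == N then 0 else i.+1)%N :> nat.
Proof.
case: ifP => /= [/eqP ->|iN]; first by rewrite modnn.
by rewrite modn_small//; move: (ltn_ord i); lia.
Qed.

Lemma ord_pred_val (i : 'I_N) :
  ord_pred i = (if i == 0 :> nat then N.-1 else i.-1)%N :> nat.
Proof.
have iN := ltn_ord i; case: ifP => /= [/eqP ->|i0].
  by rewrite add0n modn_small//; lia.
rewrite (_ : (i + N).-1 = (i.-1 + N)%N); last lia.
by rewrite modnDr modn_small//; lia.
Qed.

Definition edge_area i p := area (v i) (v (ordS i)) p.

(** The points [v i] are the vertices of a convex polygon, in counterclockwise
    order. *)
Definition convex_cycle := forall i j, j != i -> j != ordS i ->
  0 < edge_area i (v j).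

(** A lattice point whose insertion would keep the vertices of the polygon
    violates this condition at the edge that it is beyond. *)
Definition saturated_cycle := forall i p,
  0 < edge_area (ord_pred i) p -> 0 < edge_area (ordS i) p ->
  0 <= edge_area i p.

End Cycles.

Section CyclePolygon.
Local Open Scope classical_set_scope.
Local Open Scope ring_scope.
Local Open Scope convex_scope.
Local Open Scope card_scope.
Variable R : realType.

Lemma card_eq_adjoin (T : choiceType) (A : set T) (x : T) (k n : nat) :
  A #= `I_k -> A `|` [set x] #= `I_n -> ~ A x -> n = k.+1.
Proof.
move=> Ak An nAx; have fA : finite_set A by apply/finite_setP; exists k.
rewrite -(card_fset_set An) -(card_fset_set Ak) setUC fset_setU1// cardfsU1.
by rewrite in_fset_set// memNset.
Qed.

Definition real_point (p : 'rV[int]_2) : 'rV[R]_2 := map_mx intr p.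

Lemma area_real p q r :
  area (real_point p) (real_point q) (real_point r) = (area p q r)%:~R.
Proof. by rewrite /area !mxE -!intrB -!intrM -intrB. Qed.

Lemma integer_pointsP x :
  @integer_points R x <-> exists p, x = real_point p.
Proof.
split=> [/mxOverP xZ|[p ->]]; last first.
  by apply/mxOverP => i j; rewrite mxE; apply/intrP; exists (p i j).
have /cid [a ea] : exists a : int, x 0 0 = a%:~R by apply/intrP.
have /cid [b eb] : exists b : int, x 0 1 = b%:~R by apply/intrP.
exists (\row_(k < 2) if k == 0 then a else b).
by apply: row2P; rewrite !mxE.
Qed.

Lemma convex_half_plane (a b : 'rV[R]_2) :
  convex_set [set p : convex_lmodType 'rV[R]_2 | 0 <= area a b p].
Proof.
apply/convex_setP => x y t /= hx hy t0 t1.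
by rewrite area_conv addr_ge0// mulr_ge0// ?subr_ge0 ltW.
Qed.

Lemma det2 (M : 'M[R]_2) : \det M = M 0 0 * M 1 1 - M 0 1 * M 1 0.
Proof.
rewrite (expand_det_row _ 0) !big_ord_recl big_ord0 /cofactor !det_mx11 !mxE.
rewrite (_ : lift 0 0 = 1); last exact: val_inj.
rewrite (_ : lift 1 0 = 0); last exact: val_inj.
by rewrite expr0 expr1; ring.
Qed.

Lemma two_dimensional_area (P : set (convex_lmodType 'rV[R]_2))
    (a b c : 'rV[R]_2) :
  P a -> P b -> P c -> area a b c != 0 -> two_dimensional P.
Proof.
move=> Pa Pb Pc abc; exists a, b, c; split=> //.
apply: (@mxrank_unit _ 2).
set M := col_mx _ _.
have Mb k : M (0 : 'I_2) k = b 0 k - a 0 k.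
  rewrite (_ : (0 : 'I_2) = @lshift 1 1 0); last exact: val_inj.
  by rewrite /M col_mxEu !mxE.
have Mc k : M (1 : 'I_2) k = c 0 k - a 0 k.
  rewrite (_ : (1 : 'I_2) = @rshift 1 1 0); last exact: val_inj.
  by rewrite /M col_mxEd !mxE.
by rewrite unitmxE unitfE det2 !Mb !Mc.
Qed.

Lemma discrete_sign_change (s : nat -> R) a b : (a < b)%N ->
  0 <= s a -> s b <= 0 -> exists i, [/\ (a <= i < b)%N, 0 <= s i & s i.+1 <= 0].
Proof.
elim: b => // b IH ab sa sb; have [sb0|sb0] := lerP 0 (s b).
  by exists b; split=> //; lia.
have {}ab : (a < b)%N.
  move: ab; rewrite ltnS leq_eqVlt => /predU1P [eab|//].
  by rewrite ltNge -eab sa in sb0.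
have [i [iab si sSi]] := IH ab sa (ltW sb0).
by exists i; split=> //; lia.
Qed.

Variables (k : nat) (v : 'I_k.+3 -> 'rV[int]_2).
Hypotheses (v_convex : convex_cycle v) (v_saturated : saturated_cycle v).

Let w i := real_point (v i).
Let edge i p := area (w i) (w (ordS i)) p.
Let P : set (convex_lmodType 'rV[R]_2) := conv_hull (range w).

Lemma ordS_neq (i : 'I_k.+3) : ordS i != i.
Proof.
by apply/eqP => /(congr1 (@nat_of_ord _)); rewrite ordS_val; case: ifP; lia.
Qed.

Lemma ordSS_neq (i : 'I_k.+3) : ordS (ordS i) != i.
Proof.
apply/eqP => /(congr1 (@nat_of_ord _)); rewrite !ordS_val.
by move: (ltn_ord i); do 2 case: ifP; lia.
Qed.

Lemma edge_vertex_gt0 i j : j != i -> j != ordS i -> 0 < edge i (w j).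
Proof. by move=> ji jSi; rewrite /edge area_real ltr0z; apply: v_convex. Qed.

Lemma edge_vertex_ge0 i j : 0 <= edge i (w j).
Proof.
have [->|ji] := eqVneq j i; first by rewrite /edge areapp.
have [->|jSi] := eqVneq j (ordS i); first by rewrite /edge areaqq.
exact/ltW/edge_vertex_gt0.
Qed.

Lemma hull_edge_ge0 i (p : 'rV[R]_2) : P p -> 0 <= edge i p.
Proof.
suff: P `<=` [set p | 0 <= edge i p] by apply.
apply: conv_hull_min; first exact: convex_half_plane.
by move=> _ [j _ <-]; apply: edge_vertex_ge0.
Qed.

(** A point on the left of all the edges is in a triangle of the fan with apex
    [w ord0]: the rays from this apex to the successive vertices turn
    counterclockwise, the point is on the left of the first one and on the right
    of the last one, so it is between two consecutive rays. *)
Lemma edges_hull (p : 'rV[R]_2) : (forall i, 0 <= edge i p) -> P p.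
Proof.
move=> p_in; pose s i := area (w ord0) (w (inord i)) p.
have inordS i : (i < k.+2)%N -> ordS (inord i) = inord i.+1 :> 'I_k.+3.
  move=> ik; apply: ord_inj.
  by rewrite ordS_val !inordK; [case: ifP; lia|lia..].
have [] := @discrete_sign_change s 1 k.+2 => //.
- rewrite /s -inordS// (_ : inord 0 = ord0) ?p_in//.
  by apply: val_inj; rewrite /= inordK.
- rewrite /s area_swap oppr_le0 area_rot area_rot.
  rewrite (_ : ord0 = ordS (inord k.+2)) ?p_in//.
  by apply: ord_inj; rewrite ordS_val inordK// eqxx.
move=> i [/andP[i1 ik] si sSi].
pose a := w ord0; pose b := w (inord i); pose c := w (inord i.+1).
have abc : 0 < area a b c.
  rewrite area_rot /b /c -inordS//; apply: edge_vertex_gt0.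
    by rewrite -val_eqE/= inordK; lia.
  by rewrite inordS// -val_eqE/= inordK//; lia.
apply: (@convex_weighted3 _ _ a b c p (area b c p) (area c a p) (area a b p)).
- exact: convex_conv_hull.
- by apply: sub_conv_hull; exists ord0.
- by apply: sub_conv_hull; exists (inord i).
- by apply: sub_conv_hull; exists (inord i.+1).
- by rewrite /b /c -inordS//; apply: p_in.
- by rewrite area_rot area_swap oppr_ge0.
- exact: si.
- by rewrite -area_split.
- by rewrite -area_split barycentric.
Qed.

Lemma corner_gt0 i : 0 < area (w (ord_pred i)) (w i) (w (ordS i)).
Proof.
rewrite -{2}[i]ord_predK; apply: edge_vertex_gt0; last first.
  by rewrite ord_predK ordS_neq.
by rewrite -{1}[i]ord_predK ordSS_neq.
Qed.

(** Each [w i] is extreme: the two edges at [w i] are nonnegative on the hull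
    and vanish together only at [w i]. *)
Lemma vertices_hull : vertices P = range w.
Proof.
apply/seteqP; split; first exact: vertices_conv_hull_sub.
move=> _ [i _ <-]; split; first by apply: sub_conv_hull; exists i.
have Pi x : P x -> 0 <= area (w (ord_pred i)) (w i) x.
  by move=> /(hull_edge_ge0 (ord_pred i)); rewrite /edge ord_predK.
have c0 := corner_gt0 i.
have corner x : area (w (ord_pred i)) (w i) x = 0 -> edge i x = 0 -> x = w i.
  move=> x1 x2; have := barycentric (w (ord_pred i)) (w i) (w (ordS i)) x.
  rewrite x1 [area (w i) _ x]x2 !scale0r add0r addr0.
  have -> : area (w (ordS i)) (w (ord_pred i)) x =
            area (w (ord_pred i)) (w i) (w (ordS i)).
    by rewrite [RHS](area_split _ _ _ x) x1 [area (w i) _ x]x2 add0r addr0.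
  by move/(scalerI (lt0r_neq0 c0)).
move=> x y t Px Py /andP[t0 t1] iE.
(* A function that is affine on the segment, nonnegative at its ends and zero
   at an interior point is zero at both ends. *)
have zero (f : 'rV[R]_2 -> R) : f (w i) = 0 -> 0 <= f x -> 0 <= f y ->
    f (t%:num *: x + (1 - t%:num) *: y) = t%:num * f x + (1 - t%:num) * f y ->
    f x = 0 /\ f y = 0.
  move=> fi fx fy; rewrite (_ : _ + _ = w i) ?fi; last exact/esym.
  by split; nra.
have [||||x1 y1] := zero (area (w (ord_pred i)) (w i));
  rewrite ?areaqq ?Pi ?area_conv//.
have [||||x2 y2] := zero (edge i);
  rewrite ?hull_edge_ge0 /edge ?areapp ?area_conv//.
by split; apply: corner.
Qed.

Lemma real_vertex_inj : injective w.
Proof.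
move=> i j ij; apply/eqP; apply: contraT => nij.
have [iSj|niSj] := eqVneq i (ordS j).
  have : 0 < edge i (w j).
    by apply: edge_vertex_gt0; rewrite 1?eq_sym// iSj ordSS_neq.
  by rewrite -ij /edge areapp ltxx.
have := edge_vertex_gt0 nij niSj.
by rewrite ij /edge areapp ltxx.
Qed.

Lemma lattice_polygon_hull : lattice_polygon P.
Proof.
split; last first.
  by rewrite vertices_hull => _ [i _ <-]; apply/integer_pointsP; exists (v i).
split; last first.
  by exists (range w) => //; apply: finite_image; apply: finite_finset.
have in_P i : P (w i) by apply: sub_conv_hull; exists i.
apply: two_dimensional_area (in_P (ord_pred ord0)) (in_P ord0)
  (in_P (ordS ord0)) _.
exact/lt0r_neq0/corner_gt0.
Qed.

Lemma hull_has_n_vertices : has_n_vertices k.+3 P.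
Proof.
rewrite /has_n_vertices vertices_hull.
apply: card_eq_trans (inj_card_eq (in2W real_vertex_inj)) _.
by rewrite card_eq_sym card_II.
Qed.

(** With [a] and [b] the neighbours of [w i], the barycentric coordinates of [x]
    in the triangle [a (w i) b] are nonpositive at [a] and [b]. Solving for
    [w i] expresses it as a combination with nonnegative coefficients of [x],
    [a] and [b], with a positive one at [x]. *)
Lemma blocked_vertex i (x : 'rV[R]_2) :
  ~ P x -> area (w (ord_pred i)) (w i) x <= 0 -> edge i x <= 0 ->
  ~ vertices (conv_hull (P `|` [set x])) (w i).
Proof.
move=> nPx x1 x2 vi; have c0 := corner_gt0 i.
have in_P j : P (w j) by apply: sub_conv_hull; exists j.
pose a := w (ord_pred i); pose b := w (ordS i).
pose al := - area (w i) b x; pose be := - area a (w i) x.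
have al0 : 0 <= al by rewrite oppr_ge0.
have be0 : 0 <= be by rewrite oppr_ge0.
have bary : area a (w i) b *: x + al *: a + be *: b =
    (area a (w i) b + (al + be)) *: w i.
  rewrite barycentric [area a (w i) b](area_split _ _ _ x) /al /be.
  by apply: row2P; rewrite !mxE; ring.
have [s0|sn0] := eqVneq (al + be) 0.
  have [al00 be00] : al = 0 /\ be = 0 by split; lra.
  apply: nPx; move: bary; rewrite al00 be00 !scale0r !addr0.
  by move/(scalerI (lt0r_neq0 c0)) => ->.
have sp : 0 < al + be by rewrite lt_neqAle eq_sym sn0 addr_ge0.
pose q := (al + be)^-1 *: (al *: a + be *: b).
have qE : (al + be) *: q = al *: a + be *: b by rewrite scalerA mulfV// scale1r.
have Pq : P q.
  by apply: (convex_weighted2 (a := al) (b := be) (@convex_conv_hull _ _)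
    (in_P _) (in_P _)) qE.
have xi : x = w i.
  apply: (vertex_weighted2 (a := area a (w i) b) (b := al + be)
    (y := q) vi) => //.
  - by apply: sub_conv_hull; right.
  - by apply: sub_conv_hull; left.
  - by rewrite qE -bary addrA.
by apply: nPx; rewrite xi.
Qed.

Lemma not_insertable x : integer_points x -> ~ can_be_inserted x P.
Proof.
move=> /integer_pointsP [p xE] [nPx vE].
have vw i : vertices (conv_hull (P `|` [set x])) (w i).
  by rewrite vE; left; rewrite vertices_hull; exists i.
have [i ix] : exists i, edge i x < 0.
  apply: contrapT => /forallNP h; apply: nPx; apply: edges_hull => i.
  by rewrite leNgt; apply/negP/h.
have nle j : edge (ord_pred j) x <= 0 -> edge j x <= 0 -> False.
  rewrite {1}/edge ord_predK => e1 e2; exact: (blocked_vertex nPx e1 e2 (vw j)).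
have pred_gt0 : 0 < edge (ord_pred i) x.
  by rewrite ltNge; apply/negP => /nle; apply; exact: ltW.
have succ_gt0 : 0 < edge (ordS i) x.
  have := nle (ordS i); rewrite ordSK => /(_ (ltW ix)) nleS.
  by rewrite ltNge; apply/negP.
have edgeZ j : edge j x = (edge_area v j p)%:~R by rewrite xE /edge area_real.
have := @v_saturated i p.
by rewrite -!(ltr0z R) -(ler0z R) -!edgeZ leNgt ix => /(_ pred_gt0 succ_gt0).
Qed.

(** An insertion into the polygon is impossible, and one that results in the
    polygon starts from a polygon with one vertex less. *)
Lemma hull_isolated (Q : set (convex_lmodType 'rV[R]_2)) :
  ~ gedge (induced_subgraph (Lambda2 R)
    [set P | has_n_vertices k.+3 P \/ has_n_vertices k.+4 P]) P Q.
Proof.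
move=> [_ Qn [_ [_ Qlat] [[x xins QE]|[x [nQx vE] PE]]]].
  apply: (not_insertable _ xins); apply: Qlat.
  by case: xins => _; rewrite -QE => ->; right.
have nvx : ~ vertices Q x by case=> /nQx.
have := hull_has_n_vertices; rewrite PE /has_n_vertices vE => Pn.
by case: Qn => Qn; have := card_eq_adjoin Qn Pn nvx; lia.
Qed.

End CyclePolygon.

(** * Polygons bounded by a convex and a concave chain *)

Section Chains.
Local Open Scope ring_scope.

(** Height above the line that carries the chord of [f] from [i] to [i + 1]. *)
Definition chord_gap (f : nat -> int) (i : nat) (x y : int) : int :=
  y - f i - (f i.+1 - f i) * (x - i%:Z).

Definition strictly_convex (m : nat) (f : nat -> int) := forall i j,
  (i < m)%N -> (j <= m)%N -> j != i -> j != i.+1 -> 0 < chord_gap f i j (f j).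

Lemma chord_gap_ge0 m f i j : strictly_convex m f -> (i < m)%N -> (j <= m)%N ->
  0 <= chord_gap f i j (f j).
Proof.
move=> fc im jm; have [->|ji] := eqVneq j i; first by rewrite /chord_gap; lia.
have [->|jSi] := eqVneq j i.+1; first by rewrite /chord_gap; lia.
exact/ltW/fc.
Qed.

(** Two consecutive chords of a convex chain meet above [i + 1], and the second
    one is the higher of the two exactly on the right of this abscissa. Hence a
    point between them is on the right of [i + 1] when it is above the first
    one; [chord_gap_right] is the mirror image. *)
Lemma chord_gap_left m f i x y : strictly_convex m f -> (i.+1 < m)%N ->
  0 < chord_gap f i x y -> chord_gap f i.+1 x y < 0 -> i.+1%:Z < x.
Proof.
move=> fc im; have := fc i i.+2 ltac:(lia) ltac:(lia) ltac:(lia) ltac:(lia).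
rewrite /chord_gap => h gi gSi; have [//|xi] := ltrP i.+1%:Z x.
have : 0 <= (f i.+2 - 2 * f i.+1 + f i) * (i.+1%:Z - x).
  by apply: mulr_ge0; lia.
lia.
Qed.

Lemma chord_gap_right m f i x y : strictly_convex m f -> (i.+1 < m)%N ->
  0 < chord_gap f i.+1 x y -> chord_gap f i x y < 0 -> x < i.+1%:Z.
Proof.
move=> fc im; have := fc i i.+2 ltac:(lia) ltac:(lia) ltac:(lia) ltac:(lia).
rewrite /chord_gap => h gi gSi; have [//|xi] := ltrP x i.+1%:Z.
have : 0 <= (f i.+2 - 2 * f i.+1 + f i) * (x - i.+1%:Z).
  by apply: mulr_ge0; lia.
lia.
Qed.

Definition int_point (x y : int) : 'rV[int]_2 :=
  \row_(k < 2) if k == 0 then x else y.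

Variables (m N : nat) (f g : nat -> int).

(** The chain [f] is followed from left to right, then [g] from right to left.
    Abscissas determine the indices: [i] below and [2m + 1 - i] above. When
    [f 0 = g 0], the last point of [g] repeats the first one of [f], and is left
    out by taking [N = 2m + 1]. *)
Definition chain_vertex (i : nat) : 'rV[int]_2 :=
  if (i <= m)%N then int_point i (f i)
  else int_point (m.*2.+1 - i)%N (g (m.*2.+1 - i)%N).

Definition chain_cycle (i : 'I_N) := chain_vertex i.

Let ng (i : nat) := - g i.

Hypotheses (m_gt0 : (0 < m)%N) (f_convex : strictly_convex m f).
Hypothesis g_concave : strictly_convex m ng.
Hypothesis fg : forall i, (0 < i <= m)%N -> f i < g i.
Hypothesis left_end :
  (N = m.*2.+2 /\ f 0%N < g 0%N) \/ (N = m.*2.+1 /\ f 0%N = g 0%N).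

(** The upper chain is seen through the convex function [- g], by reflection in
    the horizontal axis. The last branch is the vertical edge on the left, which
    exists when [f 0 < g 0]. *)
Let edge (i : nat) (x y : int) : int :=
  if (i < m)%N then chord_gap f i x y
  else if i == m then (g m - f m) * (m%:Z - x)
  else if (i <= m.*2)%N then chord_gap ng (m.*2 - i) x (- y)
  else (g 0%N - f 0%N) * x.

Lemma chain_edge (i : 'I_N) p :
  edge_area chain_cycle i p = edge i (p 0 0) (p 0 1).
Proof.
rewrite /edge_area /chain_cycle /area /chain_vertex ordS_val /edge.
have iN := ltn_ord i.
have bounds : (N = m.*2.+1 \/ N = m.*2.+2)%N.
  by case: left_end => -[-> _]; [right|left].
have [im|im] := ltnP i m.
  rewrite (ltnW im) (_ : (i.+1 == N) = false) ?im; last lia.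
  by rewrite !mxE /= /chord_gap; lia.
have [->|nim] := eqVneq (i : nat) m.
  rewrite leqnn (_ : (m.+1 == N) = false) ?ltnn /=; last lia.
  rewrite (_ : m.*2.+1 - m.+1 = m)%N; last lia.
  by rewrite !mxE /=; lia.
have mi : (m < i)%N by lia.
rewrite [(i <= m)%N]leqNgt mi /=.
have [i2m|i2m] := leqP i m.*2.
  rewrite (_ : m.*2.+1 - i = (m.*2 - i).+1)%N; last lia.
  have [SiN|SiN] := eqVneq i.+1 N.
    have [i2 g0] : i = m.*2 :> nat /\ g 0%N = f 0%N.
      by case: left_end => -[NE gf]; split; lia.
    rewrite leq0n i2 subnn !mxE /= /chord_gap /ng g0; lia.
  rewrite (_ : (i < m)%N = false); last lia.
  rewrite subSS !mxE /= /chord_gap /ng; lia.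
rewrite (_ : m.*2.+1 - i = 0)%N; last lia.
rewrite (_ : (i.+1 == N) = true); last lia.
by rewrite !mxE /=; lia.
Qed.

Lemma chain_convex : convex_cycle chain_cycle.
Proof.
move=> i j ji jSi; rewrite chain_edge /edge /chain_cycle /chain_vertex.
have {}ji : (j : nat) != i by [].
have {jSi} : (j : nat) != ordS i by [].
rewrite ordS_val => jSi.
have iN := ltn_ord i; have jN := ltn_ord j.
have bounds : (N = m.*2.+1 \/ N = m.*2.+2)%N.
  by case: left_end => -[-> _]; [right|left].
have fg_even l : (l <= m)%N -> N = m.*2.+2 -> f l < g l.
  move=> lm NE; case: left_end => -[NE' fg0]; last lia.
  by have [->//|l0] := posnP l; apply: fg; rewrite l0.
have [im|im] := ltnP i m.
  have [jm|jm] := leqP j m; rewrite !mxE /=.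
    by apply: f_convex => //; move: jSi; case: ifP; lia.
  set l := (_ - j)%N.
  have lg : f l < g l.
    by have [l0|l0] := posnP l; [apply: fg_even; lia | apply: fg; lia].
  have := @chord_gap_ge0 m f i l f_convex im ltac:(lia).
  by rewrite /chord_gap; lia.
have [im'|nim] := eqVneq (i : nat) m.
  have gfm := fg (i := m) ltac:(lia).
  apply: mulr_gt0; first lia.
  by case: leqP => jm; rewrite !mxE /=; move: jSi; case: ifP; lia.
have [i2m|i2m] := leqP i m.*2; last first.
  have := fg_even 0%N ltac:(lia) ltac:(lia) => fg0.
  apply: mulr_gt0; first lia.
  by case: leqP => jm; rewrite !mxE /=; move: jSi; case: ifP; lia.
set l' := (m.*2 - i)%N; have [jm|jm] := leqP j m; rewrite !mxE /=.
  have := @chord_gap_ge0 m ng l' j g_concave ltac:(lia) ltac:(lia).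
  have [j0|j0] := posnP j; last first.
    by have := fg (i := j) ltac:(lia); rewrite /chord_gap /ng; lia.
  case: left_end => -[NE fg0].
    by rewrite j0 /chord_gap /ng; lia.
  move=> _; have := @g_concave l' j ltac:(lia) ltac:(lia)
    ltac:(move: jSi; case: ifP; lia) ltac:(lia).
  by rewrite j0 /chord_gap /ng; lia.
by apply: g_concave; move: jSi; case: ifP; lia.
Qed.

(** The conditions at the ends. They cannot follow from convexity: beyond a
    vertical edge, or around a common endpoint of the chains, the region to be
    avoided is not confined to a strip of width one. *)
Hypothesis right_edge : forall x y,
  0 < chord_gap f m.-1 x y -> 0 < chord_gap ng m.-1 x (- y) -> x <= m%:Z.
Hypothesis left_edge : f 0%N < g 0%N -> forall x y,
  0 < chord_gap f 0 x y -> 0 < chord_gap ng 0 x (- y) -> 0 <= x.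
Hypothesis left_corner : f 0%N = g 0%N -> [/\ (1 < m)%N,
  forall x y, 0 < chord_gap ng 0 x (- y) -> 0 < chord_gap f 1 x y ->
    0 <= chord_gap f 0 x y
  & forall x y, 0 < chord_gap f 0 x y -> 0 < chord_gap ng 1 x (- y) ->
    0 <= chord_gap ng 0 x (- y)].

Lemma edge_lower i x y : (i < m)%N -> edge i x y = chord_gap f i x y.
Proof. by rewrite /edge => ->. Qed.

Lemma edge_right x y : edge m x y = (g m - f m) * (m%:Z - x).
Proof. by rewrite /edge ltnn eqxx. Qed.

Lemma edge_upper i x y : (m < i <= m.*2)%N ->
  edge i x y = chord_gap ng (m.*2 - i) x (- y).
Proof. by rewrite /edge => /andP[mi ->]; rewrite ltnNge (ltnW mi) gtn_eqF. Qed.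

Lemma edge_left x y : edge m.*2.+1 x y = (g 0%N - f 0%N) * x.
Proof. by rewrite /edge ltnn !ifF//; lia. Qed.

(** A lattice point violating saturation at a nonvertical edge would have an
    abscissa strictly between two consecutive integers. *)
Lemma chain_saturated : saturated_cycle chain_cycle.
Proof.
move=> i p; rewrite !chain_edge ord_pred_val ordS_val.
move: (p 0 0) (p 0 1) => x y {p} prev next.
have iN := ltn_ord i; rewrite leNgt; apply/negP => ilt0.
have gfm := fg (i := m) ltac:(lia).
have [im|im] := ltnP i m.
  rewrite edge_lower// in ilt0.
  have SiN : (i.+1 == N) = false by case: left_end => -[NE _]; lia.
  rewrite SiN /= in next.
  have xSi : x < i.+1%:Z.
    have [Sim|Sim] := ltnP i.+1 m.
      by apply: (chord_gap_right f_convex Sim _ ilt0); rewrite -edge_lower.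
    have Sim' : i.+1 = m by lia.
    by move: next; rewrite Sim' edge_right pmulr_rgt0; lia.
  have ix : i%:Z < x.
    have [i0|i0] := posnP i; last first.
      rewrite -(ltn_predK i0) in im ilt0 *.
      apply: (chord_gap_left f_convex im _ ilt0); rewrite -edge_lower; last lia.
      by move: prev; rewrite ifF//; lia.
    move: prev; rewrite i0 eqxx.
    case: left_end => -[NE fg0].
      by rewrite NE edge_left pmulr_rgt0//; lia.
    have [m1 lc _] := left_corner fg0.
    rewrite NE /= edge_upper ?subnn; last lia.
    move=> prev; have := lc x y prev; rewrite i0 edge_lower// in next.
    by rewrite i0 in ilt0; move=> /(_ next); lia.
  lia.
have [im'|nim] := eqVneq (i : nat) m.
  have SmN : (m.+1 == N) = false by case: left_end => -[NE _]; lia.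
  move: prev next ilt0; rewrite im' SmN edge_right ifF; last lia.
  rewrite edge_lower; last lia.
  rewrite edge_upper; last lia.
  rewrite (_ : m.*2 - m.+1 = m.-1)%N; last lia.
  by move=> lo up; rewrite pmulr_rlt0; last lia; have := right_edge lo up; lia.
have [i2m|i2m] := leqP i m.*2; last first.
  case: left_end => -[NE fg0]; last lia.
  have iE : i = m.*2.+1 :> nat by lia.
  move: prev next ilt0; rewrite iE NE eqxx /= edge_left (@edge_lower 0)//.
  rewrite edge_upper ?subnn; last lia.
  move=> up lo; rewrite pmulr_rlt0; last lia.
  by have := left_edge fg0 lo up; lia.
rewrite edge_upper in ilt0; last lia.
rewrite ifF in prev; last lia.
set l := (m.*2 - i)%N in ilt0.
have xSl : x < l.+1%:Z.
  have [Sim|Sim] := eqVneq (i : nat) m.+1.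
    by move: prev; rewrite Sim edge_right pmulr_rgt0; lia.
  have Sl : (l.+1 < m)%N by lia.
  apply: (chord_gap_right g_concave Sl _ ilt0).
  by rewrite (_ : l.+1 = m.*2 - i.-1)%N -?edge_upper//; lia.
have lx : l%:Z < x.
  have [l0|l0] := posnP l; last first.
    have lm : (l.-1.+1 < m)%N by lia.
    rewrite -(ltn_predK l0) in ilt0 *.
    apply: (chord_gap_left g_concave lm _ ilt0).
    move: next; rewrite ifF; last by case: left_end => -[NE _]; lia.
    by rewrite edge_upper; [rewrite (_ : _ - _ = l.-1)%N//|]; lia.
  have iE : i = m.*2 :> nat by lia.
  case: left_end => -[NE fg0].
    by move: next; rewrite iE l0 ifF; [rewrite edge_left pmulr_rgt0//; lia|lia].
  have [m1 _ uc] := left_corner fg0.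
  move: next; rewrite ifT; last lia.
  rewrite edge_lower// => lo.
  rewrite edge_upper in prev; last lia.
  rewrite (_ : m.*2 - i.-1 = 1)%N in prev; last lia.
  by have := uc x y lo prev; rewrite l0 in ilt0; lia.
lia.
Qed.

End Chains.

(** * The two families of polygons *)

Section Families.
Local Open Scope ring_scope.

Definition parabola (m i : nat) : int := i%:Z * (i%:Z - m%:Z).

Lemma consecutive_mul_gt0 (i j : nat) : j != i -> j != i.+1 ->
  0 < (j%:Z - i%:Z) * (j%:Z - i%:Z - 1).
Proof. by move=> ji jSi; nia. Qed.

Lemma parabola_convex m c : strictly_convex m (fun i => parabola m i - c).
Proof.
move=> i j im jm ji jSi; have := consecutive_mul_gt0 ji jSi.
by congr (0 < _); rewrite /chord_gap /parabola -addn1 PoszD; ring.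
Qed.

(** Beyond the right end, at distance [t > 0], the chords at the end leave room
    only for an ordinate [y] with [(m - 1) t < y < 1 - (m - 1) t]; likewise on
    the left. *)
Lemma even_cycle m : (0 < m)%N ->
  exists v : 'I_(m.*2.+2) -> _, convex_cycle v /\ saturated_cycle v.
Proof.
case: m => // m _; set M := m.+1.
pose f := parabola M; pose g i := 1 - f i.
have fc : strictly_convex M f.
  have := @parabola_convex M 0; congr strictly_convex.
  by apply/funext => i; rewrite subr0.
have gc : strictly_convex M (fun i => - g i).
  have := @parabola_convex M 1; congr strictly_convex.
  by apply/funext => i; rewrite /g opprB.
have fg i : (0 < i <= M)%N -> f i < g i.
  move=> /andP[i0 iM]; have : 0 <= i%:Z * (M%:Z - i%:Z) by apply: mulr_ge0; lia.
  by rewrite /g /f /parabola; lia.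
have le : (M.*2.+2 = M.*2.+2 /\ f 0%N < g 0%N) \/
    (M.*2.+2 = M.*2.+1 /\ f 0%N = g 0%N).
  by left; rewrite /g /f /parabola !mul0r.
exists (@chain_cycle M _ f g); split; first exact: chain_convex.
apply: chain_saturated => //.
- move=> x y; rewrite /chord_gap /g /f /parabola /= => lo up.
  have [//|xM] := lerP x M%:Z.
  have : 0 <= m%:Z * (x - M%:Z) by apply: mulr_ge0; lia.
  by rewrite /M in lo up xM *; lia.
- move=> _ x y; rewrite /chord_gap /g /f /parabola /= => lo up.
  have [//|x0] := lerP 0 x.
  have : 0 <= m%:Z * (- x) by apply: mulr_ge0; lia.
  by rewrite /M in lo up *; lia.
Qed.

(** Lifting the parabola [i^2 - b i] by 1 except at 0 makes the first two slopes
    [2 - b] and [3 - b] differ by 1 instead of 2. With the difference 2, the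
    lattice point below the endpoint [(0, 0)] could be inserted in the polygon
    whose chains meet there. *)
Definition pinched_parabola (b : int) (i : nat) : int :=
  if i == 0%N then 0 else i%:Z ^+ 2 - b * i%:Z + 1.

Lemma pinched_parabola_convex m b : strictly_convex m (pinched_parabola b).
Proof.
move=> i j im jm ji jSi; have := consecutive_mul_gt0 ji jSi.
rewrite /chord_gap /pinched_parabola.
by case: i {im} ji jSi => [|i]; case: j {jm} => [|j] //=; nia.
Qed.

(** Beyond the right end, at distance [t > 0], the chords at the end impose
    [1 + (m - 1) t < y < m - 1 - (m - 2) t], hence [(2m - 3) t < m - 2], which
    is absurd. Near the left end, the three lines force [x < 0] and
    [0 < (m - 2) x]. *)
Lemma odd_cycle m : (2 < m)%N ->
  exists v : 'I_(m.*2.+1) -> _, convex_cycle v /\ saturated_cycle v.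
Proof.
move=> m3; pose f := pinched_parabola m%:Z.
pose g i := - pinched_parabola m.+1%:Z i.
have fc : strictly_convex m f := @pinched_parabola_convex m _.
have gc : strictly_convex m (fun i => - g i).
  have := @pinched_parabola_convex m m.+1%:Z.
  by congr strictly_convex; apply/funext => i; rewrite /g opprK.
have fg i : (0 < i <= m)%N -> f i < g i.
  move=> /andP[i0 im]; rewrite /g /f /pinched_parabola gtn_eqF//.
  have : 0 <= (i%:Z - 1) * (m%:Z - i%:Z) by apply: mulr_ge0; lia.
  lia.
have le : (m.*2.+1 = m.*2.+2 /\ f 0%N < g 0%N) \/
    (m.*2.+1 = m.*2.+1 /\ f 0%N = g 0%N).
  by right.
exists (@chain_cycle m _ f g); split; first by apply: chain_convex => //; lia.
apply: chain_saturated => //; first lia.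
- move=> x y; rewrite /chord_gap /g /f /pinched_parabola.
  case: m m3 {f g fc gc fg le} => [|[|m]] // m3 /= lo up.
  have [//|xM] := lerP x m.+2%:Z.
  have : 0 <= m%:Z * (x - m.+2%:Z) by apply: mulr_ge0; lia.
  by rewrite !expr2 in lo up *; nia.
- move=> _; split; first lia.
    move=> x y; rewrite /chord_gap /g /f /pinched_parabola /= => up lo.
    have [//|bad] := lerP 0 (y - 0 - _).
    have : 0 <= (m%:Z - 2) * (- x) by apply: mulr_ge0; lia.
    lia.
  move=> x y; rewrite /chord_gap /g /f /pinched_parabola /= => lo up.
  have [//|bad] := lerP 0 (- y - _ - _).
  have : 0 <= (m%:Z - 2) * (- x) by apply: mulr_ge0; lia.
  lia.
Qed.

Lemma exists_saturated_cycle n : (3 <= n)%N -> n <> 3%N -> n <> 5%N ->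
  exists v : 'I_n -> _, convex_cycle v /\ saturated_cycle v.
Proof.
move=> n3 nn3 nn5; rewrite -(odd_double_half n); case: (boolP (odd n)) => no.
  by apply: odd_cycle; lia.
have -> : (false + n./2.*2 = (n./2.-1).*2.+2)%N by lia.
by apply: even_cycle; lia.
Qed.

Lemma translate_convex N (v : 'I_N -> 'rV[int]_2) t :
  convex_cycle v -> convex_cycle (fun i => v i + t).
Proof.
by move=> vc i j ji jSi; rewrite /edge_area area_translate; apply: vc.
Qed.

End Families.

(** * Disconnectedness *)

Lemma isolated_reach (T : Type) (G : graph T) x y :
  (forall z, ~ gedge G x z) -> clos_refl_trans T (gedge G) x y -> x = y.
Proof.
move=> iso xy; elim: xy iso => [{}x {}y e iso|//|a b c _ IHab _ IHbc iso].
  by case: (iso _ e).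
by have ab := IHab iso; rewrite ab; apply: IHbc; rewrite -ab.
Qed.

Unset Implicit Arguments.
Local Open Scope classical_set_scope.

Theorem theorem1p4 (R : realType) (n : nat) (n_ge3 : (3 <= n)%N)
    (n_neq3 : n <> 3%N) (n_neq5 : n <> 5%N) :
  disconnected (induced_subgraph (Lambda2 R)
    [set P | has_n_vertices n P \/ has_n_vertices n.+1 P]).
Proof.
have [v [vc vs]] := exists_saturated_cycle n_ge3 n_neq3 n_neq5.
case: n n_ge3 n_neq3 n_neq5 v vc vs => [|[|[|k]]] // _ _ _ v vc vs.
pose t := int_point 1 0; pose u i := (v i + t)%R.
have uc : convex_cycle u by apply: translate_convex.
pose hull (w : 'I_k.+3 -> 'rV[int]_2) : set (convex_lmodType 'rV[R]_2) :=
  conv_hull (range (fun i => real_point R (w i))).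
exists (hull v), (hull u).
split.
- by split; [exact: lattice_polygon_hull|left; exact: hull_has_n_vertices].
- by split; [exact: lattice_polygon_hull|left; exact: hull_has_n_vertices].
move=> reach; have vu : hull v = hull u.
  apply: (isolated_reach _ reach) => Q; exact: (hull_isolated vc vs).
have := congr1 (@vertices R) vu; rewrite /hull !vertices_hull// => ranges.
(* A leftmost vertex of the translate [hull u] has an abscissa larger by one
   than a leftmost vertex of [hull v]. *)
case: (arg_minP (fun i => v i ord0 ord0) (isT : xpredT ord0)) => i _ imin.
have [j _ /matrixP/(_ ord0 ord0)] :
    range (fun i => real_point R (u i)) (real_point R (v i)).
  by rewrite -ranges; exists i.
rewrite !mxE /= => /intr_inj vij.
by have := imin j isT; rewrite -vij; lia.
Qed.
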